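(* Let $b\ge 2$ and $n\ge 1$ be integers and let $p\ge 1$ be such that the $(+b,n,p)$-carries process, respectively the $(-b,n,p)$-carries process, is defined (i.e. $\frac{b-1}{p}\in\mathbf N$, respectively $\frac{b+1}{p}\in\mathbf N$), with transition matrix $P_p^{\pm}$. Let $N=\sharp\,\mathcal C_p(n)$ and let $L_p=\{v^{(p)}_{ij}(n)\}_{0\le i,j\le N-1}$ be the matrix with entries $$v^{(p)}_{ij}(n)=\sum_{r=0}^{j}(-1)^r\binom{n+1}{r}\{p(j-r)+1\}^{n-i},$$ the matrix of left eigenvectors of $P_p^{\pm}$. Let $R_p:=L_p^{-1}=\{u^{(p)}_{ij}(n)\}_{0\le i,j\le N-1}$ be the matrix composed of the right eigenvectors of $P_p^{\pm}$. Then for all $0\le i,j\le N-1$, $$u^{(p)}_{ij}(n)=\sum_{k=i}^{n}\ \sum_{l=n-j}^{k}\frac{s(k,l)\,(-1)^{n-j-l}}{k!\,p^{l}}\binom{l}{n-j}\binom{n-i}{n-k}.$$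
   Context: $\mathbf N$ is the set of positive integers. $\mathcal D(b)=\{0,1,\dots,b-1\}$. $\mathcal C_p(n)=\{0,1,\dots,n-1\}$ if $p=1$ and $\mathcal C_p(n)=\{0,1,\dots,n\}$ if $p\neq 1$. The $(\pm b,n,p)$-carries process $\{\kappa_k^{\pm}\}_{k\ge 0}$ is the Markov chain on $\mathcal C_p(n)$ defined as follows. Given $\kappa^{\pm}_{k-1}$, draw $Y_1,\dots,Y_n$ independently and uniformly from $\mathcal D(b)$ (independently of the past); then $\kappa_k^{\pm}$ is the unique integer for which there is $s\in\mathcal D(b)$ with $$\kappa^{+}_{k-1}+Y_1+\dots+Y_n+A_+(b)=\kappa^+_k\,b+s \quad\text{(for }+b),\qquad \kappa^{-}_{k-1}+Y_1+\dots+Y_n+A_-(b)=(n-\kappa^-_k)\,b+s\quad\text{(for }-b),$$ where $A_+(b)=(b-1)\left(1-\frac1p\right)$ and $A_-(b)=\frac{b+1}{p}-1$. Its transition matrix is $P_p^{\pm}(i,j)=\mathbf P(\kappa_1^{\pm}=j\mid\kappa_0^{\pm}=i)$, $i,j\in\mathcal C_p(n)$. It is known (earlier work) that $P_p^{\pm}=L_p^{-1}D_b^{\pm}L_p$ with $D_b^{\pm}=\mathrm{diag}\left(1,(\pm\frac1b),\dots,(\pm\frac1b)^{N-1}\right)$; hence the rows of $L_p$ are left eigenvectors and the columns of $L_p^{-1}$ are right eigenvectors of $P_p^{\pm}$. $s(k,l)$ is the (signed) Stirling number of the first kind: $s(k,l)=(-1)^{k-l}\,\sharp\{\sigma\in S_k:\sigma\text{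 has }l\text{ cycles}\}$, so that $x(x-1)\cdots(x-k+1)=\sum_{l\ge0}s(k,l)x^l$. *)

(* Defs.v *)
(* MathComp *)
From HB Require Import structures.
From mathcomp Require Import all_boot all_order all_algebra all_fingroup.

Set Implicit Arguments.
Unset Strict Implicit.
Unset Printing Implicit Defensive.

Import Order.TTheory GRing.Theory Num.Theory.
Local Open Scope ring_scope.

(* In all definitions below, the boolean neg selects the base: +b when it is
   false, -b when it is true. *)

Definition process_defined (R : realFieldType) (neg : bool) (b : nat) (p : R)
    : Prop :=
  exists2 m : nat,
    (0 < m)%N & (if neg then b%:R + 1 else b%:R - 1) / p = m%:R.

(* C_p(n) is {0, ..., nb_carries n p - 1}. *)
Definition nb_carries (R : realFieldType) (n : nat) (p : R) : nat :=
  if p == 1 then n else n.+1.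

Definition carry_shift (R : realFieldType) (neg : bool) (b : nat) (p : R) : R :=
  if neg then (b%:R + 1) / p - 1 else (b%:R - 1) * (1 - p^-1).

(* j is the next carry when the current carry is i and the drawn digits are y *)
Definition next_carry (R : realFieldType) (neg : bool) (b n : nat) (p : R)
    (i : nat) (y : {ffun 'I_n -> 'I_b}) (j : nat) : bool :=
  [exists s : 'I_b,
     i%:R + \sum_(t < n) (y t)%:R + carry_shift neg b p
     == (if neg then n%:R - j%:R else j%:R) * b%:R + s%:R].

(* Transition probabilities: the digit vector is uniform on D(b)^n. *)
Definition carry_transition (R : realFieldType) (neg : bool) (b n : nat) (p : R)
    : 'M[R]_(nb_carries n p) :=
  \matrix_(i, j)
    (#|[set y : {ffun 'I_n -> 'I_b} | next_carry neg p i y j]|%:R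
     / #|{ffun 'I_n -> 'I_b}|%:R).

Definition carry_eigenvalues (R : realFieldType) (neg : bool) (b n : nat) (p : R)
    : 'M[R]_(nb_carries n p) :=
  diag_mx (\row_k ((if neg then - b%:R^-1 else b%:R^-1) ^+ k)).

(* Both subtractions are exact: r <= j in the sum, and i <= n since
   i < nb_carries n p. *)
Definition left_eigenmx (R : realFieldType) (n : nat) (p : R)
    : 'M[R]_(nb_carries n p) :=
  \matrix_(i, j)
    \sum_(0 <= r < j.+1)
      (-1) ^+ r * 'C(n.+1, r)%:R * (p * (j - r)%:R + 1) ^+ (n - i).

Definition right_eigenmx (R : realFieldType) (n : nat) (p : R)
    : 'M[R]_(nb_carries n p) :=
  invmx (left_eigenmx n p).

(* Signed Stirling number of the first kind. The cycles of a permutation are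
   its orbits, fixed points included; when k < l there is no such permutation,
   so the truncated exponent is harmless. *)
Definition stirling1 (k l : nat) : int :=
  (-1) ^+ (k - l) * #|[set s : 'S_k | #|porbits s| == l]|%:Z.

(* Main.v *)
Require Import Defs.
From HB Require Import structures.
From mathcomp Require Import all_boot all_order all_algebra all_fingroup.
From mathcomp Require Import ring zify.

Set Implicit Arguments.
Unset Strict Implicit.
Unset Printing Implicit Defensive.

Import Order.TTheory GRing.Theory Num.Theory.
Local Open Scope ring_scope.

(** Let [f_i] be the polynomial
    [f_i(y) = C((y - 1) / p + n - i, n)] in the variable [y], where
    [C(x, k) = x (x - 1) ... (x - k + 1) / k!].  Expanding it first by
    Vandermonde's identity and then by Stirling numbers of the first kind shows
    that the coefficient of [y ^ (n - j)] in [f_i] is exactly the claimed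
    [u_ij] ([coef_right_poly], [horner_right_poly]).  So let [U] be the matrix
    of these coefficients.

    Column [l] of the left eigenmatrix [L] combines the vectors of powers
    [(y ^ (n - j))_j] at the points [y = p k + 1], [k <= l], with the weights
    [(-1)^r C(n+1, r)], [r = l - k].  Multiplying by [U] on the left turns the
    powers into values of [f_i]; inserting the diagonal matrix of the powers of
    [1 / c] only dilates the evaluation points by [c]
    ([coef_mx_diag_left]):
      [(U diag(c^-j) L)_il
         = c^-n sum_(r <= l) (-1)^r C(n+1, r) f_i(c (p (l - r) + 1))].
    For [c = 1], [c = b] and [c = -b], the values of [f_i] that occur are,
    respectively, [C(k + n - i, n)], [C(b k + m + n - i, n)] and
    [(-1)^n C(b k + m + i - 1, n)], where [k = l - r] and [m = (b - 1) / p],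
    respectively [m = (b + 1) / p].

    The resulting alternating sums of binomials all come from a single formula:
    with [b] digits (and [b = 1] for [c = 1]) they are coefficients of
    [X^n (1 + X + ... + X^(b-1))^(n+1)] ([coef_digit_poly_exp_trunc]).
    For [b = 1] this is a coefficient of [X^n], whence [U L = 1] and [U] is the
    inverse of [L].  For [b >= 2] the coefficient counts the sequences of
    [n + 1] digits with prescribed sum, that is, the [n] digits drawn by the
    process together with the remainder [s] of its defining equation; hence
    [U diag((+-1/b)^j) L] is the transition matrix. *)

(** * Stirling numbers of the first kind and falling factorials *)

Lemma card_porbits1 (T : finType) : #|porbits (1%g : {perm T})| = #|T|.
Proof.
rewrite card_imset // => x y /setP/(_ x).
by rewrite porbit_id porbit_sym => /esym/porbitP[k ->]; rewrite expg1n perm1.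
Qed.

(** Multiplying by [tperm a y] inserts the fixed point [a] into the cycle of
    [y]. *)
Lemma card_porbits_tperm_mul (T : finType) (s : {perm T}) (a y : T) :
  s a = a -> y != a -> (#|porbits (tperm a y * s)%g|.+1 = #|porbits s|)%N.
Proof.
move=> sa ya; have := porbits_mul_tperm s a y; rewrite /= eq_sym ya.
have -> : a \notin porbit s y.
  rewrite porbit_sym; apply/negP => /porbitP[k yE]; case/eqP: ya.
  by rewrite yE; elim: k {yE} => [|k IHk]; rewrite ?perm1 // expgSr permM IHk.
by rewrite /= -[(1.*2)%N]/2%N; lia.
Qed.

(** Induction on [A]: a permutation [s] of [A] arises from one fixing a chosen
    [a] by inserting [a] either as a cycle of its own or just after some
    [y != a], where [y] is the preimage of [a].  The former keeps the number of
    cycles, the latter decreases it by one.  Working with permutations of a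
    fixed type supported on [A], rather than with ['S_k] for varying [k], avoids
    transporting cycles between types; the price is that the points outside
    [A] count as cycles, which the two powers of ['X] compensate. *)
Lemma sum_perm_on_porbits (K : idomainType) (T : finType) (A : {set T}) :
  'X^#|A| * (\sum_(s : {perm T} | perm_on A s) 'X^#|porbits s|)
    = 'X^#|T| * \prod_(t < #|A|) ('X + t%:R) :> {poly K}.
Proof.
have [m cA] : exists m, #|A| = m by exists #|A|.
elim: m A cA => [|m IHm] A cA.
  have A0 : A = set0 by apply/eqP; rewrite -cards_eq0 cA.
  rewrite cA big_ord0 mul1r mulr1 (big_pred1 1%g) ?card_porbits1 // => s.
  apply/idP/eqP => [/perm_on_id -> //|->]; last exact: perm_on1.
  by rewrite cA.
have [a aA] : exists a, a \in A by apply/card_gt0P; rewrite cA.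
have cB : #|A :\ a| = m by have := cardsD1 a A; rewrite aA cA => -[].
pose g (B : {set T}) := \sum_(s : {perm T} | perm_on B s) 'X^#|porbits s| : {poly K}.
have fixa s : perm_on (A :\ a) s -> s a = a.
  by move=> sB; apply: (out_perm sB); rewrite !inE eqxx.
have gA : g A = \sum_(y in A) \sum_(s | perm_on (A :\ a) s)
    'X^#|porbits (tperm a y * s)%g|.
  rewrite /g (partition_big (fun s : {perm T} => (s^-1)%g a) (mem A)) /=; last first.
    by move=> s sA; rewrite (perm_closed a (perm_onV sA)).
  apply: eq_bigr => y yA.
  rewrite (reindex_onto (fun s => tperm a y * s)%g (fun s => tperm a y * s)%g) /=;
    last by move=> s _; rewrite mulgA tperm2 mul1g.
  apply: eq_bigl => s; rewrite mulgA tperm2 mul1g eqxx andbT.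
  have tA : perm_on A (tperm a y).
    by apply/subsetP => z /(subsetP (tperm_on a y)); rewrite !inE => /orP[] /eqP->.
  rewrite invMg tpermV permM; apply/andP/idP => [[sA /eqP sV]|sB].
    have sa : s a = a.
      have sVa : (s^-1)%g a = a by rewrite -[LHS](tpermK a y) sV tpermR.
      by rewrite -{1}sVa permKV.
    apply/subsetP => z sz; rewrite !inE; apply/andP; split.
      have szz : s z != z by exact: sz.
      by apply: contraNneq szz => ->; rewrite sa.
    have: perm_on A s by rewrite -[s]mul1g -(tperm2 a y) -mulgA; apply: perm_onM.
    by move/subsetP; apply.
  split.
    apply: perm_onM tA _; apply: subset_trans sB _; exact: subsetDl.
  by rewrite -{2}(fixa s sB) permK tpermL.
have XgA : 'X * g A = ('X + m%:R) * g (A :\ a).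
  rewrite gA (bigD1 a aA) /= mulrDr mulrDl; congr (_ + _).
    by congr (_ * _); apply: eq_bigr => s _; rewrite tperm1 mul1g.
  rewrite mulr_sumr (eq_bigr (fun => g (A :\ a))); last first.
    move=> y /andP[_ ya]; rewrite /g mulr_sumr; apply: eq_bigr => s sB.
    by rewrite -exprS (card_porbits_tperm_mul (fixa s sB) ya).
  rewrite (eq_bigl (mem (A :\ a))); last by move=> y; rewrite !inE andbC.
  by rewrite sumr_const cB mulr_natl.
have gB := IHm _ cB; rewrite cB in gB.
by rewrite cA exprSr -mulrA -/(g A) XgA mulrCA gB mulrCA big_ord_recr /= [X in _ * X]mulrC.
Qed.

Lemma sum_porbits (K : idomainType) (k : nat) :
  \sum_(s : 'S_k) 'X^#|porbits s| = \prod_(t < k) ('X + t%:R) :> {poly K}.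
Proof.
have := sum_perm_on_porbits K [set: 'I_k]; rewrite cardsT card_ord.
move/(mulfI (monic_neq0 (monicXn K k))) => <-; apply: eq_bigl => s.
by apply/esym/subsetP => x _; rewrite inE.
Qed.

Lemma card_porbits_le (k : nat) (s : 'S_k) : (#|porbits s| <= k)%N.
Proof. by rewrite -[leqRHS]card_ord; apply: leq_imset_card. Qed.

(** The substitution [x := - x] in the generating function of the numbers of
    cycles produces the signs. *)
Lemma stirling1_gen (K : idomainType) (k : nat) (x : K) :
  \sum_(l < k.+1) (stirling1 k l)%:~R * x ^+ l = \prod_(t < k) (x - t%:R).
Proof.
have /(congr1 (horner^~ (- x))) := sum_porbits K k.
rewrite horner_sum horner_prod => H.
have -> : \prod_(t < k) (x - t%:R)
    = (-1) ^+ k * \prod_(t < k) ('X + t%:R : {poly K}).[- x].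
  rewrite -[in (-1) ^+ _](card_ord k) -prodr_const -big_split /=.
  by apply: eq_bigr => t _; rewrite hornerD hornerX -polyC_natr hornerC; ring.
rewrite -H mulr_sumr (partition_big (fun s => inord #|porbits s| : 'I_k.+1) predT) //=.
apply: eq_bigr => l _.
have lE (s : 'S_k) : (inord #|porbits s| == l) = (#|porbits s| == l).
  by rewrite -val_eqE /= inordK // ltnS card_porbits_le.
rewrite (eq_bigl (fun s : 'S_k => #|porbits s| == l)) //.
rewrite (eq_bigr (fun=> (-1) ^+ (k - l) * x ^+ l)); last first.
  move=> s /eqP->; rewrite hornerXn [(- x) ^+ l]exprNn mulrA -exprD.
  have lk : (l <= k)%N by rewrite -ltnS.
  by rewrite -signr_odd -[in RHS]signr_odd oddD (oddB lk).
rewrite sumr_const /stirling1 cardsE rmorphM rmorphXn rmorphN1 /=.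
by rewrite -mulr_natr mulrAC.
Qed.

(** * Sums of digits and alternating sums of binomials *)

Definition digit_poly (R : nzRingType) (b : nat) : {poly R} := \sum_(d < b) 'X^d.

(** The power series identity [sum_k C(k, n) X^k = X^n / (1 - X)^(n+1)],
    truncated at degree [K]. *)
Lemma mul_bin_poly (R : comNzRingType) (n K : nat) :
  exists S : {poly R},
    (1 - 'X) ^+ n.+1 * (\poly_(k < K) 'C(k, n)%:R) = 'X^n + 'X^K * S.
Proof.
elim: n => [|n [S IHn]].
  exists (-1); rewrite poly_def expr1 expr0 mulrN1 -opprB mulNr -(opprB 'X^K) subrX1.
  by congr (- (_ * _)); apply: eq_bigr => k _; rewrite bin0 scale1r.
(* Pascal's rule; the last term is the overflow at the truncation degree. *)
have step : (1 - 'X) * (\poly_(k < K) 'C(k, n.+1)%:R)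
    = 'X * (\poly_(k < K) 'C(k, n)%:R) - 'C(K, n.+1)%:R *: 'X^K
      :> {poly R}.
  rewrite !poly_def; elim: K {S IHn} => [|K IHK].
    by rewrite !big_ord0 bin0n scale0r subr0 !mulr0.
  have E (x v Q1 Q2 c d : {poly R}) : (1 - x) * Q1 = x * Q2 - c * v ->
      (1 - x) * (Q1 + c * v) = x * (Q2 + d * v) - (c + d) * (x * v).
    by rewrite mulrDr => ->; ring.
  rewrite !big_ord_recr /= binS natrD exprS -!mul_polyC polyCD.
  by apply: E; rewrite mul_polyC.
exists ('X * S - (1 - 'X) ^+ n.+1 * 'C(K, n.+1)%:R%:P).
have E (x v w A c : {poly R}) :
    x * (w + v * S) - A * (c * v) = x * w + v * (x * S - A * c) by ring.
by rewrite exprSr -mulrA step mulrBr mulrCA IHn -mul_polyC (exprS 'X) E.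
Qed.

(** Since [1 + ... + X^(b-1) = (1 - X^b) / (1 - X)], the left-hand polynomial is
    [(1 - X^b)^(n+1) X^n / (1 - X)^(n+1)].  The factor [X^n] turns the
    upper entries [u - r b + n] into [u - r b], so that, as [n > 0], the truncated
    subtraction [u - r * b] gives the correct value [0] when [u < r * b]. *)
Lemma coef_digit_poly_exp (R : comNzRingType) (b n u : nat) : (0 < n)%N ->
  ('X^n * digit_poly R b ^+ n.+1)`_u
    = \sum_(r < n.+2) (-1) ^+ r * 'C(n.+1, r)%:R * 'C(u - r * b, n)%:R.
Proof.
move=> n0; have [S HS] := mul_bin_poly R n u.+1.
set Q := \poly_(_ < _) _ in HS.
have HG : (1 - 'X) * digit_poly R b = 1 - 'X^b.
  by rewrite -opprB mulNr -subrX1 opprB.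
have -> : 'X^n * digit_poly R b ^+ n.+1
    = (1 - 'X^b) ^+ n.+1 * Q - 'X^(u.+1) * (S * digit_poly R b ^+ n.+1).
  by rewrite -HG exprMn mulrAC HS mulrDl -mulrA addrK.
rewrite coefB coefXnM ltnSn subr0 exprBn mulr_suml coef_sum.
apply: eq_bigr => r _.
have QE k : (k <= u)%N -> Q`_k = 'C(k, n)%:R.
  by move=> ku; rewrite /Q coef_poly ltnS ku.
rewrite expr1n mulr1 -exprM mulrnAl coefMn -[LHS]mulr_natr [RHS]mulrAC -[in LHS]mulrA.
congr (_ * _); rewrite -signr_odd -[in RHS]signr_odd !mulr_sign (mulnC b).
have <- : ('X^(r * b) * Q)`_u = 'C(u - r * b, n)%:R.
  rewrite coefXnM; case: ltnP => [ur|_]; last by rewrite QE ?leq_subr.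
  by rewrite (eqP (ltnW ur : (u - _ == 0)%N)) bin0n; case: (n) n0.
by case: (odd r); rewrite ?coefN.
Qed.

(** The bound on [a] makes the terms with [r > l] vanish: their upper entry
    is at most [a - b < n]. *)
Lemma coef_digit_poly_exp_trunc (R : comNzRingType) (b n a l : nat) :
  (0 < n)%N -> (a < n + b)%N ->
  ('X^n * digit_poly R b ^+ n.+1)`_(b * l + a)
    = \sum_(0 <= r < l.+1)
        (-1) ^+ r * 'C(n.+1, r)%:R * 'C(b * (l - r) + a, n)%:R.
Proof.
move=> n0 ab; rewrite (coef_digit_poly_exp _ _ _ n0).
(* Both sums extend to a common range, on which the added terms vanish. *)
pose F r : R := (-1) ^+ r * 'C(n.+1, r)%:R * 'C(b * l + a - r * b, n)%:R.
have F0 r : ((l < r) || (n.+1 < r))%N -> F r = 0.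
  rewrite /F => /orP[lr|/bin_small->]; last by rewrite mulr0 mul0r.
  by rewrite [X in _ * X%:R]bin_small ?mulr0 //; nia.
transitivity (\sum_(0 <= r < n.+2 + l.+1) F r).
  rewrite (big_cat_nat (n := n.+2)) ?leq_addr //= big_mkord.
  rewrite [X in _ + X]big_nat_cond [X in _ + X]big1 ?addr0 // => r.
  by move=> /andP[/andP[nr _] _]; rewrite F0 // nr orbT.
rewrite (big_cat_nat (n := l.+1)) ?leq_addl //=.
rewrite [X in _ + X]big_nat_cond [X in _ + X]big1 ?addr0; last first.
  by move=> r /andP[/andP[lr _] _]; rewrite F0 // lr.
rewrite !big_nat; apply: eq_bigr => r /andP[_ rl].
by rewrite /F; congr (_ * 'C(_, _)%:R); nia.
Qed.

Lemma digit_poly1 (R : nzRingType) : digit_poly R 1 = 1.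
Proof. by rewrite /digit_poly big_ord1. Qed.

(** The first [n] factors produce the digits [y], the last one produces [s];
    given [y], at most one [s] fits. *)
Lemma coef_digit_poly_count (R : comNzRingType) (b n u : nat) :
  ('X^n * digit_poly R b ^+ n.+1)`_u
    = #|[set y : {ffun 'I_n -> 'I_b} |
          [exists s : 'I_b, (n + \sum_(t < n) y t + s == u)%N]]|%:R.
Proof.
have En : digit_poly R b ^+ n
    = \sum_(y : {ffun 'I_n -> 'I_b}) 'X^(\sum_(t < n) y t).
  rewrite -[X in _ ^+ X](card_ord n) -prodr_const bigA_distr_bigA /=.
  by apply: eq_bigr => y _; rewrite expr_sum.
rewrite exprSr En mulr_suml mulr_sumr coef_sum -sum1_card natr_sum [RHS]big_mkcond.
apply: eq_bigr => y _; rewrite inE mulr_sumr mulr_sumr coef_sum.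
rewrite (eq_bigr (fun s : 'I_b => (n + \sum_(t < n) y t + s == u)%N%:R)); last first.
  by move=> s _; rewrite -!exprD addnA coefXn eq_sym.
case: existsP => [[s /eqP su]|no_s]; last first.
  by rewrite big1 // => s _; case: eqP => // su; case: no_s; exists s; apply/eqP.
rewrite (bigD1 s) //= su eqxx big1 ?addr0 // => s' s's.
by rewrite -su eqn_add2l val_eqE (negPf s's).
Qed.

(** * The polynomials whose coefficients form the right eigenvectors *)

Definition gbinom (R : fieldType) (x : R) (k : nat) : R :=
  (\prod_(t < k) (x - t%:R)) / k`!%:R.

Lemma fact_neq0 (R : numFieldType) (k : nat) : k`!%:R != 0 :> R.
Proof. by rewrite pnatr_eq0 -lt0n fact_gt0. Qed.

Lemma gbinom_nat (R : numFieldType) (q k : nat) :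
  gbinom q%:R k = 'C(q, k)%:R :> R.
Proof.
apply: (canLR (mulfK (fact_neq0 R k))); rewrite -natrM bin_ffact.
elim: k => [|k IHk]; first by rewrite big_ord0 ffactn0.
rewrite big_ord_recr IHk ffactnSr natrM /=.
case: (leqP k q) => [kq|qk]; first by rewrite natrB.
by rewrite ffact_small // !mul0r.
Qed.

(** Upper negation [C(- x, n) = (-1)^n C(x + n - 1, n)], in symmetric form. *)
Lemma gbinom_reflect (R : fieldType) (x : R) (n : nat) :
  gbinom (n%:R - 1 - x) n = (-1) ^+ n * gbinom x n.
Proof.
rewrite /gbinom mulrA; congr (_ / _).
rewrite -[in (-1) ^+ _](card_ord n) -prodr_const -big_split /=.
rewrite [RHS](reindex_inj rev_ord_inj) /=; apply: eq_bigr => t _.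
by rewrite natrB // -natr1; ring.
Qed.

Lemma gbinomS (R : numFieldType) (x : R) (k : nat) :
  gbinom (x + 1) k.+1 = gbinom x k.+1 + gbinom x k.
Proof.
rewrite /gbinom big_ord_recl [in X in _ = X + _]big_ord_recr /=.
have -> : \prod_(t < k) (x + 1 - (bump 0 t)%:R) = \prod_(t < k) (x - t%:R).
  by apply: eq_bigr => t _; rewrite /bump /= add1n -natr1; ring.
move: (\prod_(_ < _) _) => P; rewrite factS natrM -natr1.
by field; rewrite fact_neq0 natr1 pnatr_eq0.
Qed.

(** Vandermonde's identity; as one upper entry is a natural [N], it follows from
    Pascal's rule by induction on [N]. *)
Lemma gbinom_Vandermonde (R : numFieldType) (z : R) (N n : nat) : (N <= n)%N ->
  \sum_(j < N.+1) 'C(N, j)%:R * gbinom z (n - j) = gbinom (z + N%:R) n.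
Proof.
elim: N n => [|N IHN] n Nn.
  by rewrite big_ord1 bin0 mul1r subn0 addr0.
case: n Nn => [//|n] Nn.
rewrite -natr1 addrA gbinomS -(IHN n.+1 (ltnW Nn)) -(IHN n Nn).
rewrite big_ord_recl [X in _ = X + _]big_ord_recl !bin0 -addrA; congr (_ + _).
rewrite (eq_bigr (fun j : 'I_N.+1 =>
  'C(N, j.+1)%:R * gbinom z (n - j) + 'C(N, j)%:R * gbinom z (n - j))); last first.
  by move=> j _; rewrite /= /bump /= add1n binS natrD mulrDl subSS.
rewrite big_split /=; congr (_ + _).
by rewrite big_ord_recr /= bin_small // mul0r addr0.
Qed.

(** This is [f_i(y) = C((y - 1) / p + n - i, n)], written in the expanded form
    from which its coefficients are read off; see [horner_right_poly]. *)
Definition right_poly (R : realFieldType) (n : nat) (p : R) (i : nat) : {poly R} :=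
  \sum_(i <= k < n.+1) ('C(n - i, n - k)%:R / k`!%:R) *:
    \sum_(l < k.+1) (stirling1 k l)%:~R *: (p^-1 *: ('X - 1%:P)) ^+ l.

(** The inner sum over [l] is a falling factorial, and the outer one is
    Vandermonde's. *)
Lemma horner_right_poly (R : realFieldType) (n : nat) (p : R) (i : nat) (y : R) :
  (i <= n)%N -> (right_poly n p i).[y] = gbinom ((y - 1) / p + (n - i)%:R) n.
Proof.
move=> le_in; rewrite -gbinom_Vandermonde ?leq_subr // horner_sum.
rewrite -subSn // -(big_mkord xpredT
  (fun j => 'C(n - i, j)%:R * gbinom ((y - 1) / p) (n - j))).
(* The substitution [k = n - j] matches the two sums. *)
rewrite [LHS]big_nat_rev -[X in \sum_(X <= _ < _) _]add0n big_addn.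
rewrite [LHS]big_nat [RHS]big_nat; apply: eq_bigr => j /andP[_ jn].
have -> : (i + n.+1 - (j + i).+1 = n - j)%N by lia.
rewrite hornerZ subKn; last by lia.
rewrite -mulrA; congr (_ * _); rewrite mulrC /gbinom -stirling1_gen.
congr (_ / _); rewrite horner_sum; apply: eq_bigr => l _.
by rewrite hornerZ horner_exp hornerZ hornerXsubC [p^-1 * _]mulrC.
Qed.

Lemma coef_XsubC1_exp (R : comNzRingType) (l m : nat) :
  (('X - 1%:P) ^+ l : {poly R})`_m = (-1) ^+ (l - m) * 'C(l, m)%:R.
Proof.
rewrite addrC -polyCN exprDn.
rewrite (eq_bigr (fun i : 'I_l.+1 => ((-1) ^+ (l - i) * 'C(l, i)%:R) *: 'X^i)).
  rewrite -(poly_def _ (fun i => (-1) ^+ (l - i) * 'C(l, i)%:R)) coef_poly ltnS.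
  by case: leqP => // /bin_small->; rewrite mulr0.
by move=> i _; rewrite -polyC_exp mul_polyC mulr_natr -scalerMnl.
Qed.

Lemma coef_right_poly (R : realFieldType) (n : nat) (p : R) (i m : nat) :
  (right_poly n p i)`_m
  = \sum_(i <= k < n.+1) \sum_(m <= l < k.+1)
      (stirling1 k l)%:~R * (-1) ^ (m%:Z - l%:Z) / (k`!%:R * p ^+ l)
        * 'C(l, m)%:R * 'C(n - i, n - k)%:R.
Proof.
rewrite coef_sum; apply: eq_bigr => k _.
rewrite coefZ coef_sum mulr_sumr -(big_mkord xpredT (fun l : nat =>
  'C(n - i, n - k)%:R / k`!%:R
    * ((stirling1 k l)%:~R *: (p^-1 *: ('X - 1%:P)) ^+ l)`_m)).
rewrite [RHS](@big_nat_widenl _ _ _ m 0) // [RHS]big_mkcond.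
apply: eq_bigr => l _.
rewrite /= coefZ exprZn coefZ coef_XsubC1_exp exprVn.
case: (leqP m l) => [ml|lm] /=; last first.
  by rewrite ['C(l, m)]bin_small // !mulr0.
have -> : m%:Z - l%:Z = - (l - m)%N%:Z by rewrite -subzn // opprB.
rewrite -invr_expz -exprnP invr_sign.
rewrite invfM; ring.
Qed.

Lemma size_right_poly (R : realFieldType) (n : nat) (p : R) (i : nat) :
  (size (right_poly n p i) <= n.+1)%N.
Proof.
rewrite /right_poly big_nat; apply: (leq_trans (size_sum _ _ _)).
apply/bigmax_leqP_seq => k _ /andP[_ kn].
apply: (leq_trans (size_scale_leq _ _)).
apply: (leq_trans (size_sum _ _ _)); apply/bigmax_leqP => l _.
apply: (leq_trans (size_scale_leq _ _)); apply: (leq_trans (size_poly_exp_leq _ _)).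
have s2 : (size (p^-1 *: ('X - 1%:P) : {poly R}) <= 2)%N.
  by apply: (leq_trans (size_scale_leq _ _)); rewrite size_XsubC.
have := ltn_ord l; nia.
Qed.

(** * Products with the left eigenmatrix *)

Lemma nb_carries_le (R : realFieldType) (n : nat) (p : R) (i : nat) :
  (i < nb_carries n p)%N -> (i <= n)%N.
Proof. by rewrite /nb_carries; case: eqP => _ //; apply: ltnW. Qed.

(** When [p = 1] the index [j = n] is missing from the sum, but it would
    contribute the constant coefficient [f_i(0) = C(n - i - 1, n) = 0]. *)
Lemma sum_right_poly (R : realFieldType) (n : nat) (p : R) (i : nat) (y : R) :
  (0 < n)%N -> (i < nb_carries n p)%N ->
  \sum_(j < nb_carries n p) (right_poly n p i)`_(n - j) * y ^+ (n - j)
    = (right_poly n p i).[y].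
Proof.
move=> n0 iN; rewrite (horner_coef_wide y (size_right_poly n p i)).
rewrite [RHS](reindex_inj rev_ord_inj) /=.
move: iN; rewrite /nb_carries; case: eqP => [-> iN|_ _] //.
rewrite [RHS]big_ord_recr /= subSS subnn -horner_coef0.
rewrite horner_right_poly; last exact: ltnW.
have -> : (0 - 1) / 1 + (n - i)%:R = (n - i).-1%:R :> R.
  by rewrite -{1}(prednK (_ : (0 < n - i)%N)) ?subn_gt0 // -natr1; field.
by rewrite gbinom_nat bin_small ?mul0r ?addr0 //; lia.
Qed.

Definition coef_mx (R : realFieldType) (n : nat) (p : R) : 'M[R]_(nb_carries n p) :=
  \matrix_(i, j) (right_poly n p i)`_(n - j).

(** Since [c^-j = c^-n c^(n-j)], scaling the coefficients amounts to dilating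
    the variable of the polynomial. *)
Lemma coef_mx_diag_left (R : realFieldType) (n : nat) (p c : R)
    (i l : 'I_(nb_carries n p)) : (0 < n)%N -> c != 0 ->
  (coef_mx n p *m diag_mx (\row_k c^-1 ^+ k) *m left_eigenmx n p) i l
  = c^-1 ^+ n * \sum_(0 <= r < l.+1) (-1) ^+ r * 'C(n.+1, r)%:R
      * (right_poly n p i).[c * (p * (l - r)%:R + 1)].
Proof.
move=> n0 c0; rewrite mxE mulr_sumr.
under eq_bigr => j _ do rewrite mul_mx_diag !mxE mulr_sumr.
rewrite exchange_big /=; apply: eq_bigr => r _.
rewrite -(sum_right_poly _ n0 (ltn_ord i)) !mulr_sumr; apply: eq_bigr => j _.
have jn : (j <= n)%N := nb_carries_le (ltn_ord j).
have -> : c^-1 ^+ j = c^-1 ^+ n * c ^+ (n - j).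
  by rewrite -[X in _ = _ ^+ X * _](subnKC jn) exprD -mulrA -exprMn mulVf // expr1n mulr1.
by rewrite exprMn; ring.
Qed.

(** With [c = 1] the values of [f_i] are binomials of naturals, and the digit
    count is the one for the single digit [0]. *)
Lemma coef_mxK (R : realFieldType) (n : nat) (p : R) : (0 < n)%N -> p != 0 ->
  coef_mx n p *m left_eigenmx n p = 1%:M.
Proof.
move=> n0 p0; apply/matrixP => i l.
have -> : coef_mx n p = coef_mx n p *m diag_mx (\row_k 1^-1 ^+ k).
  rewrite (_ : \row_k _ = const_mx 1) ?diag_const_mx ?mulmx1 //.
  by apply/rowP => k; rewrite !mxE invr1 expr1n.
have le_in : (i <= n)%N := nb_carries_le (ltn_ord i).
rewrite coef_mx_diag_left ?oner_neq0 // invr1 expr1n mul1r mxE.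
transitivity (('X^n * digit_poly R 1 ^+ n.+1)`_(1 * l + (n - i))).
  rewrite coef_digit_poly_exp_trunc ?addn1 ?ltnS ?leq_subr //.
  apply: eq_bigr => r _; congr (_ * _).
  rewrite horner_right_poly // mul1r addrK mulrAC divff // mul1r.
  by rewrite -natrD gbinom_nat mul1n.
rewrite digit_poly1 expr1n mulr1 coefXn -val_eqE /=; congr (_%:R).
by congr nat_of_bool; lia.
Qed.

(** * The transition probabilities as digit counts *)

(** Replacing [s] by its complement [b - 1 - s] puts all the digits on the same
    side of the equation. *)
Lemma card_next_carry_pos (R : realFieldType) (b n m : nat) (p : R) (i l : nat) :
  p != 0 -> (b%:R - 1) / p = m%:R -> (i <= n)%N ->
  #|[set y : {ffun 'I_n -> 'I_b} | next_carry false p i y l]|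
  = #|[set y : {ffun 'I_n -> 'I_b} |
        [exists s : 'I_b, (n + \sum_(t < n) y t + s == b * l + (m + (n - i)))%N]]|.
Proof.
move=> p0 hm le_in; congr #|pred_of_set _|; apply/setP => y; rewrite !inE.
have E (s : 'I_b) :
    (i%:R + \sum_(t < n) (y t)%:R + carry_shift false b p == l%:R * b%:R + s%:R :> R)
    = (i + \sum_(t < n) y t + b == l * b + s + m + 1)%N.
  rewrite /carry_shift mulrBr mulr1 hm -(eqr_nat R) !natrD natrM natr_sum.
  by rewrite -subr_eq0 -[RHS]subr_eq0; congr (_ == _); ring.
apply/existsP/existsP => -[s]; rewrite ?E => /eqP eq_s; exists (rev_ord s);
  rewrite ?E; apply/eqP => /=; have := ltn_ord s; move: eq_s;
  move: (\sum_(_ < _) _)%N => S; clear -le_in; nia.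
Qed.

(** Here the complement is applied to the digits [y] instead. *)
Lemma card_next_carry_neg (R : realFieldType) (b n m : nat) (p : R) (i l : nat) :
  p != 0 -> (b%:R + 1) / p = m%:R -> (0 < m)%N ->
  #|[set y : {ffun 'I_n -> 'I_b} | next_carry true p i y l]|
  = #|[set y : {ffun 'I_n -> 'I_b} |
        [exists s : 'I_b, (n + \sum_(t < n) y t + s == b * l + (m + i).-1)%N]]|.
Proof.
move=> p0 hm m0.
pose rev_digits (y : {ffun 'I_n -> 'I_b}) := [ffun t => rev_ord (y t)].
have revK : involutive rev_digits.
  by move=> y; apply/ffunP => t; rewrite !ffunE rev_ordK.
rewrite -(card_imset _ (inv_inj revK)); congr #|pred_of_set _|; apply/setP => y.
rewrite (can2_imset_pre _ revK revK) !inE.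
have E (s : 'I_b) :
    (i%:R + \sum_(t < n) (rev_digits y t)%:R + carry_shift true b p
       == (n%:R - l%:R) * b%:R + s%:R :> R)
    = (n + \sum_(t < n) y t + s == b * l + (m + i).-1)%N.
  have -> : \sum_(t < n) (rev_digits y t)%:R
      = n%:R * (b%:R - 1) - (\sum_(t < n) y t)%:R :> R.
    rewrite natr_sum mulr_natl -[X in _ *+ X](card_ord n) -sumr_const -sumrB.
    by apply: eq_bigr => t _; rewrite ffunE natrB // -natr1; ring.
  rewrite /carry_shift hm -(eqr_nat R) !natrD natrM.
  have -> : (m + i).-1%:R = m%:R + i%:R - 1 :> R.
    by rewrite -natrD -(prednK (_ : (0 < m + i)%N)) ?ltn_addr // -natr1 addrK.
  rewrite -subr_eq0 -[RHS]subr_eq0 -[RHS]oppr_eq0; congr (_ == _); ring.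
by apply: eq_existsb => s; rewrite E.
Qed.

(** * Diagonalization *)

Theorem theorem1p4 (R : realFieldType) (neg : bool) (b n : nat) (p : R)
    (hb : (2 <= b)%N) (hn : (1 <= n)%N) (hp : 1 <= p)
    (hproc : process_defined neg b p) :
  [/\ left_eigenmx n p \in unitmx,
      carry_transition neg b n p
        = right_eigenmx n p *m carry_eigenvalues neg b n p *m left_eigenmx n p
    & forall i j : 'I_(nb_carries n p),
        right_eigenmx n p i j
        = \sum_(i <= k < n.+1) \sum_(n - j <= l < k.+1)
            (stirling1 k l)%:~R * (-1) ^ (n%:Z - j%:Z - l%:Z)
              / (k`!%:R * p ^+ l)
              * 'C(l, n - j)%:R * 'C(n - i, n - k)%:R].
Proof.
have p_gt0 : 0 < p := lt_le_trans ltr01 hp.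
have p0 : p != 0 := lt0r_neq0 p_gt0.
have UL := coef_mxK hn p0.
have [_ L_unit] := mulmx1_unit UL.
have RE : right_eigenmx n p = coef_mx n p.
  by rewrite -[LHS]mul1mx -UL -mulmxA mulmxV // mulmx1.
split=> // [|i j]; last first.
  rewrite RE mxE coef_right_poly; do 2![apply: eq_bigr => ? _].
  by rewrite (subzn (nb_carries_le (ltn_ord j))).
case: hproc => m m0 hm; have {}hm : (if neg then b%:R + 1 else b%:R - 1) = m%:R * p.
  by rewrite -hm divfK.
apply/matrixP => i l; rewrite RE mxE card_ffun !card_ord.
have le_in : (i <= n)%N := nb_carries_le (ltn_ord i).
have b0 : b%:R != 0 :> R by rewrite pnatr_eq0; case: (b) hb.
have mulp : m%:R <= m%:R * p by rewrite ler_peMr.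
case: neg hm => hm; rewrite /carry_eigenvalues /=.
(* [m <= b + 1] and [i <= n] are not both equalities, as [m = b + 1] forces
   [p = 1], and then [i < n]. *)
- have hmb : (m + i <= n + b)%N.
    have : (m <= b.+1)%N by rewrite -(ler_nat R) -natr1 hm.
    move: (ltn_ord i); rewrite {2}/nb_carries; case: eqP => [_|/eqP p1 _ _]; first lia.
    have : (m < b.+1)%N.
      by rewrite -(ltr_nat R) -[b.+1%:R]natr1 hm ltr_pMr ?ltr0n // lt_def p1.
    lia.
  rewrite (card_next_carry_neg _ _ _ p0 _ m0) ?hm ?mulfK // -coef_digit_poly_count.
  rewrite coef_digit_poly_exp_trunc //; last by lia.
  rewrite -invrN coef_mx_diag_left ?oppr_eq0 //.
  rewrite natrX -exprVn mulrC invrN exprNn -mulrA mulrCA; congr (_ * _).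
  rewrite mulr_sumr; apply: eq_bigr => r _; rewrite mulrCA; congr (_ * _).
  rewrite horner_right_poly //; move: (l - r)%N => k.
  (* The shape of the right-hand side is the one to which reflection applies. *)
  have -> : (- b%:R * (p * k%:R + 1) - 1) / p + (n - i)%:R
      = n%:R - 1 - (b * k + (m + i).-1)%:R :> R.
    rewrite natrD natrM -subn1 (natrB _ le_in) natrB ?ltn_addr // ?natrD.
    have -> : - b%:R * (p * k%:R + 1) - 1
        = - (b%:R * k%:R + m%:R) * p :> R by rewrite [RHS]mulNr [X in _ = - X]mulrDl -hm; ring.
    rewrite mulfK //; ring.
  by rewrite gbinom_reflect gbinom_nat signrMK.
- have hmb : (m < b)%N.
    by rewrite -(ler_nat R) -natr1 -lerBrDr hm.
  rewrite (card_next_carry_pos (m := m) _ p0 _ le_in) ?hm ?mulfK // -coef_digit_poly_count.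
  rewrite coef_digit_poly_exp_trunc //; last by lia.
  rewrite coef_mx_diag_left // natrX -exprVn mulrC; congr (_ * _).
  apply: eq_bigr => r _; congr (_ * _).
  rewrite horner_right_poly //; move: (l - r)%N => k.
  have -> : (b%:R * (p * k%:R + 1) - 1) / p + (n - i)%:R
      = (b * k + (m + (n - i)))%:R :> R.
    have -> : b%:R * (p * k%:R + 1) - 1
        = (b%:R * k%:R + m%:R) * p :> R by rewrite mulrDl -hm; ring.
    by rewrite mulfK // !natrD natrM addrA.
  by rewrite gbinom_nat.
Qed.
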